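(* Let $G$ be a quantal groupoid. Then its associated quantale $\mathcal O(G)$ is a semiopen quantal frame, and it is multiplicative. Furthermore, if $G$ is an open groupoid then $\mathcal O(G)$ is an open quantal frame.
   Context: For a locale $X$, $\mathcal O(X)$ is its frame; a map of locales $f$ has inverse image frame homomorphism $f^*$. $f$ is semiopen if $f^*$ has a left adjoint $f_!$, and open if also $f_!(f^*(b)\wedge a)=b\wedge f_!(a)$. A localic groupoid is an internal groupoid in the category of locales, with domain $d$, range $r$, multiplication $m:G_2=G_1\times_{G_0}G_1\to G_1$ (composable pairs $(x,y)$ have $r(x)=d(y)$), units $u$, inversion $i$. It is quantal if $m$ is semiopen and open if $d$ is open (then $m$ is open, so $G$ is quantal). For a quantal groupoid $G$, $\mathcal O(G)$ denotes the involutive quantale whose underlying sup-lattice is the frame $\mathcal O(G_1)$, with multiplication $\mathcal O(G_1)\otimes\mathcal O(G_1)\to\mathcal O(G_2)\xrightarrow{m_!}\mathcal O(G_1)$ (the first map being the frame quotient) and involution $a^*=i_!(a)$. A quantale is a sup-lattice with an associative multiplication preserving joins in each variable (not necessarily unital). An involutive quantal frame $Q$ is a quantale with a join-preserving involution ($a^{**}=a$, $(ab)^*=b^*a^*$) whose underlying lattice is a frame; $1$ is its top. $R(Q)=\{a\in Q:a1\le a\}$ (right-sided elements). $Q$ is an $R(Q)$-$R(Q)$-bimodule via $z\cdot a=a\wedge z$, $a\cdot z=a\wedge z^*$, and $Q\otimes_{R(Q)}Q$ is the corresponding tensor product of sup-lattices (quotient of $Q\otimes Q$ by $(a\wedge z^*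 )\otimes b=a\otimes(z\wedge b)$). $Q$ is balanced if $b(a1\wedge c)=(b\wedge 1a^* )c$ for all $a,b,c$. If $Q$ is balanced and $R(Q)=Q1$, the multiplication factors through the reduced multiplication $\mu_0:Q\otimes_{R(Q)}Q\to Q$, $a\otimes b\mapsto ab$; $Q$ is multiplicative if it is balanced and the right adjoint $(\mu_0)_*$ preserves joins. Put $\upsilon(a)=\bigvee_{xy^*\le a}x\wedge y$. A balanced $Q$ is semiopen if $\upsilon(Q)\subset R(Q)$ and $\bigvee_{xx^*x\le a}x=a$ for all $a$ (this implies $R(Q)=Q1$); it is open if, furthermore, $(a1\wedge b)c=a1\wedge bc$ for all $a,b,c$.
   Formalization: Associativity of the multiplication of O(G), which can fail when m is merely semiopen (so that O(G) is then not a quantale), is added as a hypothesis for the semiopen and multiplicative claims; for open G it is not assumed but proved. *)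

(* Defs.v *)
From HB Require Import structures.
From mathcomp Require Import all_boot all_order.
From mathcomp Require Import boolp classical_sets.

Set Implicit Arguments.
Unset Strict Implicit.
Unset Printing Implicit Defensive.

Import Order.TTheory.

Local Open Scope classical_set_scope.
Local Open Scope order_scope.

(** * Sup-lattices and frames *)

HB.mixin Record POrder_isSupLattice d T of Order.POrder d T := {
  bigjoin : set T -> T;
  bigjoin_le_ubound : forall (A : set T) (x : T),
    bigjoin A <= x <-> ubound A x
}.

#[short(type="supLatticeType")]
HB.structure Definition SupLattice d :=
  {T of POrder_isSupLattice d T & Order.POrder d T}.

HB.mixin Record SupLattice_isFrame d T
    of SupLattice d T & Order.TBLattice d T := {
  meet_bigjoin : forall (x : T) (A : set T),
    x `&` bigjoin A = bigjoin [set x `&` a | a in A]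
}.

#[short(type="frameType")]
HB.structure Definition Frame d :=
  {T of SupLattice_isFrame d T & SupLattice d T & Order.TBLattice d T}.

Section SupLatticeMaps.
Context {d d' : Order.disp_t}.

Definition bigmeet {L : supLatticeType d} (A : set L) : L :=
  bigjoin (lbound A).

Definition preserves_joins {L : supLatticeType d} {M : supLatticeType d'}
    (f : L -> M) : Prop :=
  forall A : set L, f (bigjoin A) = bigjoin [set f a | a in A].

Definition left_adjoint {L : supLatticeType d} {M : supLatticeType d'}
    (g : M -> L) (f : L -> M) : Prop :=
  forall (b : M) (a : L), (g b <= a) = (b <= f a).

(* The only candidates for a left, resp. right, adjoint of [f]; see
   [ladjP] and [radjP]. *)
Definition ladj {L : supLatticeType d} {M : supLatticeType d'}
    (f : L -> M) (b : M) : L :=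
  bigmeet [set a | b <= f a].

Definition radj {L : supLatticeType d} {M : supLatticeType d'}
    (f : L -> M) (b : M) : L :=
  bigjoin [set a | f a <= b].

End SupLatticeMaps.

Section SupLatticeTheory.
Context {d : Order.disp_t} {L : supLatticeType d}.
Implicit Types (A B : set L) (x : L).

Lemma bigjoin_ub A x : A x -> x <= bigjoin A.
Proof. by apply/((bigjoin_le_ubound A (bigjoin A)).1 (lexx _)). Qed.

Lemma bigjoin_lub A x : ubound A x -> bigjoin A <= x.
Proof. by move/bigjoin_le_ubound. Qed.

Lemma bigmeet_glb A x : (x <= bigmeet A) <-> lbound A x.
Proof.
split=> [xA a Aa|xA]; last exact: bigjoin_ub.
by apply: (le_trans xA); apply: bigjoin_lub => y; apply.
Qed.

Lemma bigjoin_eq A x :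
  (forall y, x <= y <-> ubound A y) -> bigjoin A = x.
Proof.
move=> xA; apply: le_anti; apply/andP; split.
  by apply/bigjoin_lub/xA.
by apply/xA => a; exact: bigjoin_ub.
Qed.

End SupLatticeTheory.

Section Adjoints.
Context {d d' : Order.disp_t}.
Context {L : supLatticeType d} {M : supLatticeType d'}.

Lemma ladjP (f : L -> M) (g : M -> L) :
  left_adjoint g f -> g = ladj f.
Proof.
move=> gf; apply/funext => b; apply: le_anti; apply/andP; split.
  by apply/bigmeet_glb => a /=; rewrite gf.
have /bigmeet_glb : ladj f b <= bigmeet [set a | b <= f a] by [].
by apply; rewrite /= -gf.
Qed.

Lemma preserves_joins_homo (f : L -> M) :
  preserves_joins f -> {homo f : x y / x <= y}.
Proof.
move=> fJ x y xy; have -> : y = bigjoin [set x; y].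
  apply/esym/bigjoin_eq => z; split=> [yz _ [->|->] //|]; last first.
    by apply; right.
  exact: le_trans yz.
by rewrite fJ; apply: bigjoin_ub; exists x => //; left.
Qed.

Lemma radjP (f : L -> M) :
  preserves_joins f -> left_adjoint f (radj f).
Proof.
move=> fJ a b; apply/idP/idP => [fab|ab]; first exact: bigjoin_ub.
apply: (le_trans (preserves_joins_homo fJ ab)); rewrite fJ.
by apply: bigjoin_lub => _ [x xb <-].
Qed.

End Adjoints.

(** * Locales *)

Record locale := Locale {
  locale_disp : Order.disp_t;
  opens : frameType locale_disp
}.

Record frame_hom {d d'} {L : frameType d} {M : frameType d'} (f : L -> M) :
    Prop := FrameHom {
  frame_hom_join : preserves_joins f;
  frame_hom_meet : forall a b, f (a `&` b) = f a `&` f b;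
  frame_hom_top : f \top = \top
}.

Record lmap (X Y : locale) := LMap {
  inv_im : opens Y -> opens X;
  inv_im_hom : frame_hom inv_im
}.

Declare Scope locale_scope.
Delimit Scope locale_scope with L.
Local Open Scope locale_scope.
Notation "f ^*" := (inv_im f) : locale_scope.

Lemma lmap_eq (X Y : locale) (f g : lmap X Y) : f^* =1 g^* -> f = g.
Proof.
case: f g => [f fP] [g gP] /= /funext fg; subst g.
by congr LMap; exact: Prop_irrelevance.
Qed.

Lemma frame_hom_id {d} (L : frameType d) : frame_hom (@id L).
Proof. by split=> // A; rewrite image_id. Qed.

Lemma frame_hom_comp {d d' d''} (L : frameType d) (M : frameType d')
    (N : frameType d'') (f : L -> M) (g : M -> N) :
  frame_hom f -> frame_hom g -> frame_hom (g \o f).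
Proof.
move=> [fJ fM fT] [gJ gM gT]; split=> [A|a b|] /=.
- by rewrite fJ gJ image_comp.
- by rewrite fM gM.
- by rewrite fT gT.
Qed.

Definition lid (X : locale) : lmap X X := LMap (frame_hom_id (opens X)).

Definition lcomp (X Y Z : locale) (g : lmap Y Z) (f : lmap X Y) : lmap X Z :=
  LMap (frame_hom_comp (inv_im_hom g) (inv_im_hom f)).

Notation "g \c f" := (lcomp g f) (at level 50, left associativity) :
  locale_scope.

Section LocaleMaps.
Context {X Y : locale} (f : lmap X Y).

Definition direct_im : opens X -> opens Y := ladj f^*.

Definition semiopen : Prop :=
  exists g : opens X -> opens Y, left_adjoint g f^*.

Definition open : Prop :=
  exists2 g : opens X -> opens Y, left_adjoint g f^* &
    forall (b : opens Y) (a : opens X), g (f^* b `&` a) = b `&` g a.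

Lemma direct_imP : semiopen -> left_adjoint direct_im f^*.
Proof. by case=> g gf; rewrite /direct_im -(ladjP gf). Qed.

End LocaleMaps.

Definition is_pullback {X Y B P : locale} (f : lmap X B) (g : lmap Y B)
    (p : lmap P X) (q : lmap P Y) : Prop :=
  f \c p = g \c q /\
  forall (Z : locale) (x : lmap Z X) (y : lmap Z Y), f \c x = g \c y ->
    exists! h : lmap Z P, p \c h = x /\ q \c h = y.

(** * Localic groupoids *)

(* [G3] is the locale of composable triples. The maps written <x, y> and
   x * y into the pullback [G2] are those whose composites with [pr1] and
   [pr2] are the prescribed ones. *)
Record localic_groupoid := LocalicGroupoid {
  G0 : locale;
  G1 : locale;
  G2 : locale;
  G3 : locale;
  dom : lmap G1 G0;
  rng : lmap G1 G0;
  pr1 : lmap G2 G1;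
  pr2 : lmap G2 G1;
  pr12 : lmap G3 G2;
  pr23 : lmap G3 G2;
  gmul : lmap G2 G1;
  gunit : lmap G0 G1;
  ginv : lmap G1 G1;
  G2_pullback : is_pullback rng dom pr1 pr2;
  G3_pullback : is_pullback pr2 pr1 pr12 pr23;
  dom_unit : dom \c gunit = lid G0;
  rng_unit : rng \c gunit = lid G0;
  dom_mul : dom \c gmul = dom \c pr1;
  rng_mul : rng \c gmul = rng \c pr2;
  gmulA : forall mul_id id_mul : lmap G3 G2, (* gmul * id, id * gmul *)
    pr1 \c mul_id = gmul \c pr12 -> pr2 \c mul_id = pr2 \c pr23 ->
    pr1 \c id_mul = pr1 \c pr12 -> pr2 \c id_mul = gmul \c pr23 ->
    gmul \c mul_id = gmul \c id_mul;
  gmul1l : forall k : lmap G1 G2, (* k = <gunit \c dom, id> *)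
    pr1 \c k = gunit \c dom -> pr2 \c k = lid G1 -> gmul \c k = lid G1;
  gmul1r : forall k : lmap G1 G2, (* k = <id, gunit \c rng> *)
    pr1 \c k = lid G1 -> pr2 \c k = gunit \c rng -> gmul \c k = lid G1;
  dom_inv : dom \c ginv = rng;
  rng_inv : rng \c ginv = dom;
  gmulV : forall k : lmap G1 G2, (* k = <id, ginv> *)
    pr1 \c k = lid G1 -> pr2 \c k = ginv -> gmul \c k = gunit \c dom;
  gmulVl : forall k : lmap G1 G2, (* k = <ginv, id> *)
    pr1 \c k = ginv -> pr2 \c k = lid G1 -> gmul \c k = gunit \c rng
}.

Definition quantal (G : localic_groupoid) : Prop := semiopen (gmul G).

Definition open_groupoid (G : localic_groupoid) : Prop := open (dom G).

(** * Involutive quantal frames *)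

(* A frame with an arbitrary binary and an arbitrary unary operation; the
   quantale laws are the predicate [involutive_quantal_frame]. *)
Record mulFrame := MulFrame {
  mulFrame_disp : Order.disp_t;
  mulFrame_frame :> frameType mulFrame_disp;
  qmul : mulFrame_frame -> mulFrame_frame -> mulFrame_frame;
  qinv : mulFrame_frame -> mulFrame_frame
}.

Declare Scope quantale_scope.
Delimit Scope quantale_scope with Q.
Local Open Scope quantale_scope.
Notation "a * b" := (qmul a b) : quantale_scope.
Notation "a ^*" := (qinv a) : quantale_scope.

Section Quantales.
Variable Q : mulFrame.
Implicit Types a b c x y z : Q.

Record involutive_quantal_frame : Prop := InvolutiveQuantalFrame {
  qmulA : associative (@qmul Q);
  qmul_joinl : forall b, preserves_joins (fun a => a * b);
  qmul_joinr : forall a, preserves_joins (fun b => a * b);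
  qinv_join : preserves_joins (@qinv Q);
  qinvK : involutive (@qinv Q);
  qinvM : forall a b, (a * b)^* = b^* * a^*
}.

Definition right_sided : set Q := [set a | a * \top <= a].

Definition balanced : Prop :=
  forall a b c, b * (a * \top `&` c) = (b `&` \top * a^*) * c.

Definition upsilon a : Q :=
  bigjoin [set z | exists x y, x * y^* <= a /\ z = x `&` y].

Record semiopen_quantal_frame : Prop := SemiopenQuantalFrame {
  semiopen_involutive : involutive_quantal_frame;
  semiopen_balanced : balanced;
  semiopen_upsilon : forall a, right_sided (upsilon a);
  semiopen_regular : forall a, bigjoin [set x | x * x^* * x <= a] = a
}.

Record open_quantal_frame : Prop := OpenQuantalFrame {
  open_semiopen : semiopen_quantal_frame;
  open_frobenius : forall a b c, (a * \top `&` b) * c = a * \top `&` b * c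
}.

(** ** The tensor product of [Q] with itself over its right-sided elements *)

(* [Q (x)_R(Q) Q] realized as the lattice of the subsets of [Q * Q] saturated
   for the defining relations; the pure tensor [a (x) b] is the least such
   subset containing [(a, b)]. See [tensor_lift_join], [tensor_lift_pure] and
   [tensor_lift_unique] for the universal property. *)
Record saturated (U : set (Q * Q)%type) : Prop := Saturated {
  saturated_joinl : forall (A : set Q) b,
    U (bigjoin A, b) <-> forall a, A a -> U (a, b);
  saturated_joinr : forall a (B : set Q),
    U (a, bigjoin B) <-> forall b, B b -> U (a, b);
  saturated_balanced : forall z a b, right_sided z ->
    U (a `&` z^*, b) <-> U (a, z `&` b)
}.

Record tensor := Tensor {
  tset : set (Q * Q)%type;
  tset_saturated : saturated tset
}.

HB.instance Definition _ := gen_eqMixin tensor.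
HB.instance Definition _ := gen_choiceMixin tensor.

Definition le_tensor (s t : tensor) : bool := `[< (tset s `<=` tset t)%classic >].

Fact le_tensor_refl : reflexive le_tensor.
Proof. by move=> s; apply/asboolP. Qed.

Fact le_tensor_anti : antisymmetric le_tensor.
Proof.
move=> [s sP] [t tP] /andP[/asboolP /= st /asboolP /= ts].
have e : s = t by apply/seteqP.
by subst t; congr Tensor; exact: Prop_irrelevance.
Qed.

Fact le_tensor_trans : transitive le_tensor.
Proof.
move=> t s u /asboolP st /asboolP tu; apply/asboolP.
exact: subset_trans st tu.
Qed.

Fact tensor_display : Order.disp_t. Proof. by []. Qed.

HB.instance Definition _ := Order.Le_isPOrder.Build tensor_display tensor
  le_tensor_refl le_tensor_anti le_tensor_trans.

Lemma le_tensorP (s t : tensor) :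
  reflect (tset s `<=` tset t)%classic (s <= t).
Proof. exact: asboolP. Qed.

Fact smallest_saturated (S : set (Q * Q)%type) :
  saturated (smallest saturated S).
Proof.
split=> [A b|a B|z a b zR]; split.
- by move=> h a Aa U US; exact: ((saturated_joinl US.1 _ _).1 (h U US)).
- by move=> h U US; apply/(saturated_joinl US.1) => a Aa; exact: h.
- by move=> h b Bb U US; exact: ((saturated_joinr US.1 _ _).1 (h U US)).
- by move=> h U US; apply/(saturated_joinr US.1) => b Bb; exact: h.
- by move=> h U US; apply/(saturated_balanced US.1 _ _ zR); exact: h.
- by move=> h U US; apply/(saturated_balanced US.1 _ _ zR); exact: h.
Qed.

Definition tensor_span (S : set (Q * Q)%type) : tensor :=
  Tensor (smallest_saturated S).

Lemma tensor_span_le (S : set (Q * Q)%type) (t : tensor) :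
  tensor_span S <= t <-> (S `<=` tset t)%classic.
Proof.
split=> [/le_tensorP St p Sp|St].
  by apply: St; exact: sub_smallest Sp.
by apply/le_tensorP => p; apply; split=> //; exact: tset_saturated.
Qed.

Definition pure_tensor a b : tensor := tensor_span [set (a, b)].

Lemma pure_tensor_le a b (t : tensor) : pure_tensor a b <= t <-> tset t (a, b).
Proof.
by split=> [/tensor_span_le|tab]; [apply|apply/tensor_span_le => _ ->].
Qed.

Definition tensor_join (F : set tensor) : tensor :=
  tensor_span (\bigcup_(t in F) tset t)%classic.

Fact tensor_join_le (F : set tensor) (t : tensor) :
  tensor_join F <= t <-> ubound F t.
Proof.
split=> [/tensor_span_le Ft s Fs|Ft].
  by apply/le_tensorP => p sp; apply: Ft; exists s.
by apply/tensor_span_le => p [s /Ft /le_tensorP]; apply.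
Qed.

HB.instance Definition _ :=
  POrder_isSupLattice.Build tensor_display tensor tensor_join_le.

Definition tensor_lift {d} {L : supLatticeType d} (f : Q -> Q -> L)
    (t : tensor) : L :=
  bigjoin [set f p.1 p.2 | p in tset t].

Section UniversalProperty.
Context {d : Order.disp_t} {L : supLatticeType d} (f : Q -> Q -> L).
Hypothesis f_joinl : forall b, preserves_joins (fun a => f a b).
Hypothesis f_joinr : forall a, preserves_joins (fun b => f a b).
Hypothesis f_balanced : forall z a b, right_sided z ->
  f (a `&` z^*) b = f a (z `&` b).

Fact saturated_le (l : L) : saturated [set p | f p.1 p.2 <= l].
Proof.
split=> [A b|a B|z a b zR] /=.
- rewrite f_joinl; split=> [/bigjoin_le_ubound h a Aa|h].
    by apply: h; exists a.
  by apply/bigjoin_le_ubound => _ [a Aa <-]; exact: h.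
- rewrite f_joinr; split=> [/bigjoin_le_ubound h b Bb|h].
    by apply: h; exists b.
  by apply/bigjoin_le_ubound => _ [b Bb <-]; exact: h.
- by rewrite f_balanced.
Qed.

Lemma tensor_lift_le (t : tensor) (l : L) :
  tensor_lift f t <= l <-> t <= Tensor (saturated_le l).
Proof.
split=> [/bigjoin_le_ubound tl|/le_tensorP tl].
  by apply/le_tensorP => p tp; apply: tl; exists p.
by apply/bigjoin_le_ubound => _ [p /tl + <-].
Qed.

Lemma tensor_lift_pure a b : tensor_lift f (pure_tensor a b) = f a b.
Proof.
apply: le_anti; apply/andP; split.
  exact/tensor_lift_le/pure_tensor_le/lexx.
by apply: bigjoin_ub; exists (a, b) => //; exact/pure_tensor_le.
Qed.

Lemma tensor_lift_join : preserves_joins (tensor_lift f).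
Proof.
move=> F; apply/esym/bigjoin_eq => l; split.
  move=> /tensor_lift_le /bigjoin_le_ubound Fl _ [t Ft <-].
  exact/tensor_lift_le/Fl.
move=> Fl; apply/tensor_lift_le/bigjoin_le_ubound => t Ft.
by apply/tensor_lift_le; apply: Fl; exists t.
Qed.

Lemma tensor_lift_unique (g : tensor -> L) : preserves_joins g ->
  (forall a b, g (pure_tensor a b) = f a b) -> g = tensor_lift f.
Proof.
move=> gJ gf; apply/funext => t.
have {1}-> : t = bigjoin [set pure_tensor p.1 p.2 | p in tset t].
  apply/esym/bigjoin_eq => s; split.
    move=> /le_tensorP ts _ [[a b] tab <-].
    exact/pure_tensor_le/ts.
  move=> ts; apply/le_tensorP => -[a b] tab.
  by apply/pure_tensor_le/ts; exists (a, b).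
rewrite gJ /tensor_lift; congr bigjoin; apply/seteqP; split.
  by move=> _ [_ [[a b] tab <-] <-]; exists (a, b).
move=> _ [[a b] tab <-]; exists (pure_tensor a b) => //.
by exists (a, b).
Qed.

End UniversalProperty.

Definition reduced_mul : tensor -> Q := tensor_lift (@qmul Q).

Lemma reduced_mul_pure : involutive_quantal_frame -> balanced ->
  right_sided = range (fun a => a * \top) ->
  forall a b, reduced_mul (pure_tensor a b) = a * b.
Proof.
move=> Qq Qb QR a b; apply: tensor_lift_pure.
- exact: qmul_joinl Qq.
- exact: qmul_joinr Qq.
- move=> z {}a {}b; rewrite QR => -[y _ <-]; rewrite Qb.
  have top_inv : (\top : Q)^* = \top.
    apply: le_anti; rewrite lex1 /=.
    by rewrite -[leLHS](qinvK Qq); exact/(preserves_joins_homo (qinv_join Qq))/lex1.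
  by rewrite (qinvM Qq) top_inv.
Qed.

(* [R(Q) = Q1] is what makes [reduced_mul] the factorization of the
   multiplication through the tensor product; see [reduced_mul_pure]. *)
Record multiplicative : Prop := Multiplicative {
  multiplicative_balanced : balanced;
  multiplicative_right_sided : right_sided = range (fun a => a * \top);
  multiplicative_join : preserves_joins (radj reduced_mul)
}.

End Quantales.

(** * The quantale of a groupoid *)

(* The frame quotient from the tensor product of two copies of O(G1) to O(G2)
   sends a pure tensor of [a] and [b] to [(pr1 G)^* a `&` (pr2 G)^* b].
   Pitfall: if [gmul G] is semiopen but [dom G] is not open, this
   multiplication can fail to be associative. An example is the equivalence
   relation with classes {s1, v, w1} and {s0, w, t0} on the poset whose only
   strict relations are s1 < s0 and w1 < w, with upper sets as opens: with
   up(x, y) the least open containing (x, y),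
   (up(s1, v) up(v, w1)) up(w, t0) contains (s0, t0), but
   up(v, w1) up(w, t0) is empty. *)
Definition groupoid_quantale (G : localic_groupoid) : mulFrame :=
  @MulFrame _ (opens (G1 G))
    (fun a b => direct_im (gmul G) ((pr1 G)^*%L a `&` (pr2 G)^*%L b))
    (fun a => direct_im (ginv G) a).

(* Main.v *)
Require Import Defs.
From HB Require Import structures.
From mathcomp Require Import all_boot all_order.
From mathcomp Require Import boolp classical_sets.

Set Implicit Arguments.
Unset Strict Implicit.
Unset Printing Implicit Defensive.

Import Order.TTheory.

Local Open Scope classical_set_scope.
Local Open Scope order_scope.
Local Open Scope locale_scope.

(** Everything happens at the level of generalized elements. Write [x ** y] for
    the product of two composable maps [x, y : Z -> G1], and recall that
    [a * b <= c] in the quantale means that the open of composable pairs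
    given by [a] and [b] lies in the inverse image of [c] under
    multiplication. Hence [a * b <= c] bounds [x^* a `&` y^* b] by
    [(x ** y)^* c] for all composable [x] and [y] ([qmul_point]). Conversely,
    [G2] is a pullback, so its opens are joins of rectangles, and
    [(x ** y)^* c] is the join of the [x^* a `&` y^* b] with [a * b <= c]
    ([point_mul_cover]).

    These two facts turn groupoid identities into quantale identities.
    Evaluating at [x] and its inverse, whose product is the unit at the domain
    of [x], shows that a right-sided [a] is [d^* (u^* a)] and that
    [upsilon a = d^* (u^* a)]. Since [d^*] of any open is right-sided, the
    right-sided elements are exactly the opens pulled back from [G0] along the
    domain map, and the balancing condition is the equality [r pr1 = d pr2].
    Regularity is [x ** (x^-1 ** x) = x], evaluated in the same way.
    Associativity of the quantale enters in two places: to know that [a * \top]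
    is right-sided, and to rebracket a triple product.

    For multiplicativity, the saturated sets that make up the tensor product
    over the right-sided elements are the ideals of rectangles defining
    [O(G1) (x)_O(G0) O(G1)]. That lattice is a frame, indeed the frame of the
    pullback of [r] and [d]; so a rectangle of [G2] covered by the rectangles
    of a saturated set belongs to that set ([pullback_saturated]). As the right
    adjoint of the reduced multiplication is then [m^*] read on rectangles, it
    preserves joins.

    In an open groupoid the domain map is open, and open maps are stable under
    pullback with the Beck-Chevalley formula ([pullback_open]). Multiplication
    is itself a pullback of the domain map along itself, through
    [(x, y) |-> (x ** y, x)], hence open. The two maps from composable triples
    to composable pairs are pullbacks of multiplication, so both bracketings of
    a triple product of opens are the direct image of the same open of triples
    ([open_qmulA]). The remaining law is Frobenius reciprocity for
    multiplication along [d m = d pr1]. *)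

(** * Joins in frames *)

Section Joins.
Context {d : Order.disp_t}.

Lemma bigjoin2 {L : supLatticeType d} (x y : L) :
  x <= y -> bigjoin [set x; y] = y.
Proof.
move=> xy; apply: bigjoin_eq => z; split=> [yz _ [->|->] //|]; last first.
  by apply; right.
exact: le_trans yz.
Qed.

Lemma bigjoin_meet {L : frameType d} (A : set L) (x : L) :
  bigjoin A `&` x = bigjoin [set a `&` x | a in A].
Proof.
rewrite meetC meet_bigjoin; congr bigjoin; apply/seteqP.
by split=> _ [a Aa <-]; exists a => //; rewrite meetC.
Qed.

Lemma meet2_bigjoin {L : frameType d} (A B : set L) :
  bigjoin A `&` bigjoin B =
  bigjoin [set z | exists a b, [/\ A a, B b & z = a `&` b]].
Proof.
apply: le_anti; apply/andP; split.
  rewrite bigjoin_meet; apply: bigjoin_lub => _ [a Aa <-].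
  rewrite meet_bigjoin; apply: bigjoin_lub => _ [b Bb <-].
  by apply: bigjoin_ub; exists a, b.
apply: bigjoin_lub => _ [a [b [Aa Bb ->]]].
by apply: leI2; exact: bigjoin_ub.
Qed.

End Joins.

Lemma frame_hom_homo {d d'} {L : frameType d} {M : frameType d'} (f : L -> M) :
  frame_hom f -> {homo f : x y / x <= y}.
Proof. by case=> fJ _ _; exact: preserves_joins_homo. Qed.

Lemma left_adjoint_join {d d'} {L : supLatticeType d} {M : supLatticeType d'}
    (g : M -> L) (f : L -> M) : left_adjoint g f -> preserves_joins g.
Proof.
move=> gf A; apply/esym/bigjoin_eq => x; rewrite gf.
rewrite bigjoin_le_ubound; split=> [Ax _ [a Aa <-]|Ax a Aa].
  by rewrite gf; exact: Ax.
by rewrite -gf; apply: Ax; exists a.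
Qed.

(** * Pullbacks of locales *)

(** A saturated set is a set of rectangles closed under every inference valid
    in the fiber product of [X] and [Y] over [B]. Such sets form the tensor
    product of the sup-lattices [opens X] and [opens Y] over [opens B]. *)
Record fiber_saturated {X Y B : locale} (f : lmap X B) (g : lmap Y B)
    (U : set (opens X * opens Y)%type) : Prop := FiberSaturated {
  fiber_joinl : forall (A : set (opens X)) y,
    U (bigjoin A, y) <-> forall x, A x -> U (x, y);
  fiber_joinr : forall x (A : set (opens Y)),
    U (x, bigjoin A) <-> forall y, A y -> U (x, y);
  fiber_balanced : forall b x y, U (x `&` f^* b, y) <-> U (x, g^* b `&` y)
}.

Section FiberSaturated.
Context {X Y B : locale} (f : lmap X B) (g : lmap Y B).
Implicit Types (U V : set (opens X * opens Y)%type).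

Lemma fiber_saturated_down U x y x' y' : fiber_saturated f g U ->
  U (x, y) -> x' <= x -> y' <= y -> U (x', y').
Proof.
move=> Us Uxy xx yy.
have /(fiber_joinl Us) Ux : U (bigjoin [set x'; x], y) by rewrite bigjoin2.
have : U (x', bigjoin [set y'; y]) by rewrite bigjoin2//; apply: Ux; left.
by move=> /(fiber_joinr Us); apply; left.
Qed.

Lemma fiber_saturatedT : fiber_saturated f g setT.
Proof. by []. Qed.

Lemma fiber_saturatedI U V : fiber_saturated f g U -> fiber_saturated f g V ->
  fiber_saturated f g (U `&` V).
Proof.
move=> Us Vs; split.
- move=> A y; split=> [[/(fiber_joinl Us) UA /(fiber_joinl Vs) VA] x Ax|UVA].
    by split; [exact: UA|exact: VA].
  by split; [apply/(fiber_joinl Us)|apply/(fiber_joinl Vs)] => x /UVA [].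
- move=> x A; split=> [[/(fiber_joinr Us) UA /(fiber_joinr Vs) VA] y Ay|UVA].
    by split; [exact: UA|exact: VA].
  by split; [apply/(fiber_joinr Us)|apply/(fiber_joinr Vs)] => y /UVA [].
- move=> b x y; split=> -[/(fiber_balanced Us) Uxy /(fiber_balanced Vs) Vxy];
    by split.
Qed.

Definition fiber_span U := smallest (fiber_saturated f g) U.

Lemma fiber_span_saturated U : fiber_saturated f g (fiber_span U).
Proof.
split=> [A y|x A|b x y]; split.
- by move=> h x Ax V UV; exact: ((fiber_joinl UV.1 _ _).1 (h V UV)).
- by move=> h V UV; apply/(fiber_joinl UV.1) => x Ax; exact: h.
- by move=> h y Ay V UV; exact: ((fiber_joinr UV.1 _ _).1 (h V UV)).
- by move=> h V UV; apply/(fiber_joinr UV.1) => y Ay; exact: h.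
- by move=> h V UV; apply/(fiber_balanced UV.1); exact: h.
- by move=> h V UV; apply/(fiber_balanced UV.1); exact: h.
Qed.

(** For a saturated [V], the Heyting implication from the down-closure of [U]
    to [V]; it is what makes the lattice of saturated sets a frame. *)
Definition fiber_implication U V : set (opens X * opens Y)%type :=
  [set p | forall q, U q -> V (p.1 `&` q.1, p.2 `&` q.2)].

Lemma fiber_implication_saturated U V :
  fiber_saturated f g V -> fiber_saturated f g (fiber_implication U V).
Proof.
move=> Vs; split=> [A y|x A|b x y]; split.
- move=> h x Ax q Uq; have := h q Uq; rewrite /= bigjoin_meet.
  by move/(fiber_joinl Vs); apply; exists x.
- move=> h q Uq; rewrite /= bigjoin_meet; apply/(fiber_joinl Vs).
  by move=> _ [x Ax <-]; exact: (h x Ax q).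
- move=> h y Ay q Uq; have := h q Uq; rewrite /= bigjoin_meet.
  by move/(fiber_joinr Vs); apply; exists y.
- move=> h q Uq; rewrite /= bigjoin_meet; apply/(fiber_joinr Vs).
  by move=> _ [y Ay <-]; exact: (h y Ay q).
- move=> h q Uq /=; rewrite -meetA; apply/(fiber_balanced Vs).
  by rewrite meetAC; exact: (h q Uq).
- move=> h q Uq /=; rewrite meetAC; apply/(fiber_balanced Vs).
  by rewrite meetA; exact: (h q Uq).
Qed.

Record fiber_tensor := FiberTensor {
  fiber_set : set (opens X * opens Y)%type;
  fiber_setP : fiber_saturated f g fiber_set
}.

HB.instance Definition _ := gen_eqMixin fiber_tensor.
HB.instance Definition _ := gen_choiceMixin fiber_tensor.

Implicit Types s t u : fiber_tensor.

Definition fiber_le s t : bool := `[< (fiber_set s `<=` fiber_set t)%classic >].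

Lemma fiber_le_refl : reflexive fiber_le.
Proof. by move=> s; apply/asboolP. Qed.

Lemma fiber_le_anti : antisymmetric fiber_le.
Proof.
move=> [s sP] [t tP] /andP[/asboolP /= st /asboolP /= ts].
have e : s = t by apply/seteqP.
by subst t; congr FiberTensor; exact: Prop_irrelevance.
Qed.

Lemma fiber_le_trans : transitive fiber_le.
Proof.
move=> t s u /asboolP st /asboolP tu; apply/asboolP.
exact: subset_trans st tu.
Qed.

Fact fiber_display : Order.disp_t. Proof. by []. Qed.

HB.instance Definition _ := Order.Le_isPOrder.Build fiber_display fiber_tensor
  fiber_le_refl fiber_le_anti fiber_le_trans.

Lemma fiber_leP s t : reflect (fiber_set s `<=` fiber_set t)%classic (s <= t).
Proof. exact: asboolP. Qed.

Definition fiber_bigjoin (F : set fiber_tensor) : fiber_tensor :=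
  FiberTensor (fiber_span_saturated (\bigcup_(t in F) fiber_set t)%classic).

Lemma fiber_bigjoin_le (F : set fiber_tensor) t :
  fiber_bigjoin F <= t <-> ubound F t.
Proof.
split=> [/fiber_leP Ft s Fs|Ft].
  apply/fiber_leP => p sp; apply: Ft.
  by apply: sub_gen_smallest; exists s.
apply/fiber_leP => p; apply; split; first exact: fiber_setP.
by move=> q [s Fs sq]; move/fiber_leP: (Ft s Fs); apply.
Qed.

HB.instance Definition _ :=
  POrder_isSupLattice.Build fiber_display fiber_tensor fiber_bigjoin_le.

Definition fiber_meet s t : fiber_tensor :=
  FiberTensor (fiber_saturatedI (fiber_setP s) (fiber_setP t)).

Lemma fiber_meetP s t u : (s <= fiber_meet t u) = (s <= t) && (s <= u).
Proof.
apply/fiber_leP/andP => [stu|[/fiber_leP st /fiber_leP su] p sp].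
  by split; apply/fiber_leP => p /stu [].
by split; [exact: st|exact: su].
Qed.

Definition fiber_join s t : fiber_tensor := bigjoin [set s; t].

Lemma fiber_joinP s t u : (fiber_join s t <= u) = (s <= u) && (t <= u).
Proof.
apply/idP/andP => [/bigjoin_le_ubound stu|[su tu]].
  by split; apply: stu; [left|right].
by apply: bigjoin_lub => _ [->|->].
Qed.

HB.instance Definition _ := Order.POrder_MeetJoin_isLattice.Build
  fiber_display fiber_tensor fiber_meetP fiber_joinP.

Lemma fiber_le0 s : bigjoin set0 <= s.
Proof. by apply: bigjoin_lub => ? []. Qed.

Lemma fiber_le1 s : s <= FiberTensor fiber_saturatedT.
Proof. exact/fiber_leP. Qed.

HB.instance Definition _ :=
  Order.hasBottom.Build fiber_display fiber_tensor fiber_le0.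
HB.instance Definition _ :=
  Order.hasTop.Build fiber_display fiber_tensor fiber_le1.

(** Binary meet with [s] has the implication as a right adjoint, so it preserves
    joins. *)
Lemma fiber_meet_bigjoin s (F : set fiber_tensor) :
  s `&` bigjoin F = bigjoin [set s `&` t | t in F].
Proof.
apply: le_anti; apply/andP; split; last first.
  apply: bigjoin_lub => _ [t Ft <-].
  by apply: leI2 => //; exact: bigjoin_ub.
set J := bigjoin [set _ | _ in _].
pose H := FiberTensor (fiber_implication_saturated (fiber_set s) (fiber_setP J)).
have FH : bigjoin F <= H.
  apply: bigjoin_lub => t Ft; apply/fiber_leP => p tp q sq.
  suff /fiber_leP : s `&` t <= J.
    apply; split => /=.
      apply: (fiber_saturated_down (fiber_setP s) (x := q.1) (y := q.2)).
      - by case: q sq.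
      - exact: leIr.
      - exact: leIr.
    apply: (fiber_saturated_down (fiber_setP t) (x := p.1) (y := p.2)).
    - by case: p tp.
    - exact: leIl.
    - exact: leIl.
  by apply: bigjoin_ub; exists t.
apply/fiber_leP => -[x y] [sxy /(fiber_leP _ _ FH)] /(_ _ sxy) /=.
by rewrite !meetxx.
Qed.

HB.instance Definition _ :=
  SupLattice_isFrame.Build fiber_display fiber_tensor fiber_meet_bigjoin.


Definition fiber_pure x y : fiber_tensor :=
  FiberTensor (fiber_span_saturated [set (x, y)]).

Lemma fiber_pure_le x y t : fiber_pure x y <= t <-> fiber_set t (x, y).
Proof.
split=> [/fiber_leP|txy]; first by apply; exact: sub_gen_smallest.
apply/fiber_leP => p; apply; split; first exact: fiber_setP.
by move=> _ ->.
Qed.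

(** One inequality is closure under smaller rectangles; the other follows by
    applying the implication once for each generator. *)
Lemma fiber_pureI x y x' y' :
  fiber_pure x y `&` fiber_pure x' y' = fiber_pure (x `&` x') (y `&` y').
Proof.
apply: le_anti; apply/andP; split; last first.
  rewrite lexI; apply/andP; split; apply/fiber_pure_le.
    apply: (fiber_saturated_down (fiber_setP _) (x := x) (y := y)).
    - exact/fiber_pure_le.
    - exact: leIl.
    - exact: leIl.
  apply: (fiber_saturated_down (fiber_setP _) (x := x') (y := y')).
  - exact/fiber_pure_le.
  - exact: leIr.
  - exact: leIr.
set J := fiber_pure (x `&` x') _.
have J2 : fiber_pure x' y' <=
    FiberTensor (fiber_implication_saturated [set (x, y)] (fiber_setP J)).
  apply/fiber_pure_le => _ -> /=; rewrite (meetC x') (meetC y').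
  exact: sub_gen_smallest.
have /fiber_leP J1 : fiber_pure x y <= FiberTensor
    (fiber_implication_saturated (fiber_set (fiber_pure x' y')) (fiber_setP J)).
  apply/fiber_pure_le => p /(fiber_leP _ _ J2) /(_ (x, y) erefl) /=.
  by rewrite (meetC x p.1) (meetC y p.2).
by apply/fiber_leP => -[a b] [/J1 ab /ab] /=; rewrite !meetxx.
Qed.

Lemma fiber_pure_joinl (A : set (opens X)) y :
  fiber_pure (bigjoin A) y = bigjoin [set fiber_pure x y | x in A].
Proof.
apply/esym/bigjoin_eq => t; split.
  move=> /fiber_pure_le/(fiber_joinl (fiber_setP t)) tA _ [x Ax <-].
  exact/fiber_pure_le/tA.
move=> tA; apply/fiber_pure_le/(fiber_joinl (fiber_setP t)) => x Ax.
by apply/fiber_pure_le; apply: tA; exists x.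
Qed.

Lemma fiber_pure_joinr x (A : set (opens Y)) :
  fiber_pure x (bigjoin A) = bigjoin [set fiber_pure x y | y in A].
Proof.
apply/esym/bigjoin_eq => t; split.
  move=> /fiber_pure_le/(fiber_joinr (fiber_setP t)) tA _ [y Ay <-].
  exact/fiber_pure_le/tA.
move=> tA; apply/fiber_pure_le/(fiber_joinr (fiber_setP t)) => y Ay.
by apply/fiber_pure_le; apply: tA; exists y.
Qed.

Lemma fiber_pureT : fiber_pure \top \top = \top.
Proof.
apply: le_anti; rewrite lex1 /=; apply/fiber_leP => -[x y] _.
apply: (fiber_saturated_down (fiber_setP _) (x := \top) (y := \top)).
- exact/fiber_pure_le.
- exact: lex1.
- exact: lex1.
Qed.

Lemma fiber_inl_hom : frame_hom (fun x => fiber_pure x \top).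
Proof.
split=> [A|x x'|]; first exact: fiber_pure_joinl.
- by rewrite fiber_pureI meetxx.
- exact: fiber_pureT.
Qed.

Lemma fiber_inr_hom : frame_hom (fun y => fiber_pure \top y).
Proof.
split=> [A|y y'|]; first exact: fiber_pure_joinr.
- by rewrite fiber_pureI meetxx.
- exact: fiber_pureT.
Qed.

Definition fiber_locale : locale := Locale fiber_tensor.
Definition fiber_pr1 : lmap fiber_locale X := @LMap fiber_locale _ _ fiber_inl_hom.
Definition fiber_pr2 : lmap fiber_locale Y := @LMap fiber_locale _ _ fiber_inr_hom.

Lemma fiber_square : f \c fiber_pr1 = g \c fiber_pr2.
Proof.
apply: lmap_eq => b /=; apply: le_anti.
apply/andP; split; apply/fiber_pure_le.
  rewrite -[f^* b]meet1x; apply/(fiber_balanced (fiber_setP _)).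
  by rewrite meetx1; exact: sub_gen_smallest.
rewrite -[g^* b]meetx1; apply/(fiber_balanced (fiber_setP _)).
by rewrite meet1x; exact: sub_gen_smallest.
Qed.

(** Any commuting square over [f] and [g] maps to the locale of saturated sets,
    by sending a saturated set to the join of its rectangles. *)
Section Comparison.
Context {P : locale} (p : lmap P X) (q : lmap P Y).
Hypothesis fpgq : f \c p = g \c q.

Lemma fiber_saturated_le (w : opens P) :
  fiber_saturated f g [set z | p^* z.1 `&` q^* z.2 <= w].
Proof.
split=> [A y|x A|b x y] /=.
- rewrite (frame_hom_join (inv_im_hom p)) bigjoin_meet.
  split=> [/bigjoin_le_ubound Aw x Ax|Aw].
    by apply: Aw; exists (p^* x) => //; exists x.
  by apply: bigjoin_lub => _ [_ [x Ax <-] <-]; exact: Aw.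
- rewrite (frame_hom_join (inv_im_hom q)) meet_bigjoin.
  split=> [/bigjoin_le_ubound Aw y Ay|Aw].
    by apply: Aw; exists (q^* y) => //; exists y.
  by apply: bigjoin_lub => _ [_ [y Ay <-] <-]; exact: Aw.
- have /(congr1 (fun h => inv_im h b)) /= fg := fpgq.
  rewrite (frame_hom_meet (inv_im_hom p)) (frame_hom_meet (inv_im_hom q)).
  by rewrite fg meetA.
Qed.

Definition fiber_lift t : opens P :=
  bigjoin [set p^* z.1 `&` q^* z.2 | z in fiber_set t].

Lemma fiber_lift_le t w :
  fiber_lift t <= w <-> t <= FiberTensor (fiber_saturated_le w).
Proof.
split=> [/bigjoin_le_ubound tw|/fiber_leP tw].
  by apply/fiber_leP => z tz; apply: tw; exists z.
by apply: bigjoin_lub => _ [z tz <-]; exact: tw.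
Qed.

Lemma fiber_lift_hom : frame_hom fiber_lift.
Proof.
split=> [F|s t|].
- apply/esym/bigjoin_eq => w; split.
    move=> /fiber_lift_le /bigjoin_le_ubound Fw _ [t Ft <-].
    exact/fiber_lift_le/Fw.
  move=> Fw; apply/fiber_lift_le/bigjoin_le_ubound => t Ft.
  by apply/fiber_lift_le; apply: Fw; exists t.
- apply: le_anti; apply/andP; split.
    apply/fiber_lift_le/fiber_leP => z [sz tz] /=.
    by rewrite lexI; apply/andP; split; apply: bigjoin_ub; exists z.
  rewrite meet2_bigjoin; apply: bigjoin_lub.
  move=> _ [_ [_ [[[x y] sxy <-] [[x' y'] txy <-] ->]]].
  apply: bigjoin_ub; exists (x `&` x', y `&` y').
    split; [apply: fiber_saturated_down sxy _ _|apply: fiber_saturated_down txy _ _];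
      by [exact: fiber_setP|exact: leIl|exact: leIr].
  rewrite /= (frame_hom_meet (inv_im_hom p)) (frame_hom_meet (inv_im_hom q)).
  by rewrite meetACA.
- apply: le_anti; rewrite lex1 /=; apply: bigjoin_ub; exists (\top, \top) => //=.
  by rewrite (frame_hom_top (inv_im_hom p)) (frame_hom_top (inv_im_hom q)) meetxx.
Qed.

Definition fiber_pair : lmap P fiber_locale :=
  @LMap _ fiber_locale _ fiber_lift_hom.

Lemma fiber_lift_pure x y : fiber_lift (fiber_pure x y) = p^* x `&` q^* y.
Proof.
apply: le_anti; apply/andP; split.
  by apply/fiber_lift_le/fiber_pure_le; exact: lexx.
by apply: bigjoin_ub; exists (x, y) => //; exact/fiber_pure_le.
Qed.

Lemma fiber_pair_pr1 : fiber_pr1 \c fiber_pair = p.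
Proof.
apply: lmap_eq => x /=.
by rewrite fiber_lift_pure (frame_hom_top (inv_im_hom q)) meetx1.
Qed.

Lemma fiber_pair_pr2 : fiber_pr2 \c fiber_pair = q.
Proof.
apply: lmap_eq => y /=.
by rewrite fiber_lift_pure (frame_hom_top (inv_im_hom p)) meet1x.
Qed.

End Comparison.
End FiberSaturated.

Lemma lcompA (X Y Z W : locale) (h : lmap Z W) (g : lmap Y Z) (f : lmap X Y) :
  h \c (g \c f) = h \c g \c f.
Proof. exact: lmap_eq. Qed.

Lemma lcomp1 (X Y : locale) (f : lmap X Y) : f \c lid X = f.
Proof. exact: lmap_eq. Qed.

Lemma lcomp1l (X Y : locale) (f : lmap X Y) : lid Y \c f = f.
Proof. exact: lmap_eq. Qed.

Section Pullbacks.
Context {X Y B P : locale} (f : lmap X B) (g : lmap Y B).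
Context (p : lmap P X) (q : lmap P Y).
Hypothesis pb : is_pullback f g p q.

Lemma pullback_jointly_monic (Z : locale) (h k : lmap Z P) :
  p \c h = p \c k -> q \c h = q \c k -> h = k.
Proof.
move=> ph qh; case: pb => fpgq /(_ Z (p \c k) (q \c k)).
by rewrite !lcompA fpgq => /(_ erefl) [l [_ lu]]; rewrite -(lu h)// -(lu k).
Qed.

(** Map the pullback to the locale of saturated sets, where rectangles become
    generators; there, a generator below the join of the rectangles in [U] lies
    below [U] itself. *)
Lemma pullback_saturated (U : set (opens X * opens Y)%type) x y :
  fiber_saturated f g U ->
  p^* x `&` q^* y <= bigjoin [set p^* z.1 `&` q^* z.2 | z in U] -> U (x, y).
Proof.
move=> Us xyU; case: pb => _ /(_ _ _ _ (fiber_square f g)) [h [[ph qh] _]].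
have hpure a b : h^* (p^* a `&` q^* b) = fiber_pure f g a b.
  rewrite (frame_hom_meet (inv_im_hom h)).
  rewrite -[h^* (p^* a)]/((p \c h)^* a) -[h^* (q^* b)]/((q \c h)^* b) ph qh /=.
  by rewrite fiber_pureI meetx1 meet1x.
have := frame_hom_homo (inv_im_hom h) xyU.
rewrite hpure (frame_hom_join (inv_im_hom h)) => xyJ.
suff : fiber_pure f g x y <= FiberTensor Us by move/fiber_pure_le.
apply: le_trans xyJ _; apply: bigjoin_lub => _ [_ [[a b] Uab <-] <-].
by rewrite hpure; exact/fiber_pure_le.
Qed.

(** The composite of [P] with itself through the locale of saturated sets is
    the identity, as it commutes with both projections; and every open in the
    image of [fiber_lift] is a join of rectangles. *)
Lemma pullback_cover (w : opens P) :
  w = bigjoin [set p^* z.1 `&` q^* z.2 | z in [set z | p^* z.1 `&` q^* z.2 <= w]].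
Proof.
apply: le_anti; apply/andP; split; last by apply: bigjoin_lub => _ [z zw <-].
have [fpgq /(_ _ _ _ (fiber_square f g)) [h [[ph qh] _]]] := pb.
have hk : h \c fiber_pair fpgq = lid P.
  apply: pullback_jointly_monic; rewrite lcompA lcomp1.
    by rewrite ph fiber_pair_pr1.
  by rewrite qh fiber_pair_pr2.
have wE : fiber_lift p q (h^* w) = w := congr1 (fun k => inv_im k w) hk.
rewrite -{1}wE; apply: bigjoin_lub => _ [z hz <-]; apply: bigjoin_ub.
exists z => //=; rewrite -wE.
by apply: bigjoin_ub; exists z.
Qed.

(** Stability of open maps under pullback, with the Beck-Chevalley formula on
    rectangles. The image of an open is forced to be the join of the images of
    its rectangles; openness of [g] makes the rectangles with image below a
    given open of [X] a saturated set, so covers of a rectangle do not change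
    its image. *)
Lemma pullback_open (g_ : opens Y -> opens B) : left_adjoint g_ g^* ->
    (forall b y, g_ (g^* b `&` y) = b `&` g_ y) ->
  exists p_ : opens P -> opens X, [/\ left_adjoint p_ p^*,
    forall x y, p_ (p^* x `&` q^* y) = x `&` f^* (g_ y) &
    forall x w, p_ (p^* x `&` w) = x `&` p_ w].
Proof.
move=> g_adj g_frob.
have sat x' : fiber_saturated f g [set z | z.1 `&` f^* (g_ z.2) <= x'].
  split=> [A y|x A|b x y] /=.
  - rewrite bigjoin_meet; split=> [/bigjoin_le_ubound Ax x Ax'|Ax].
      by apply: Ax; exists x.
    by apply: bigjoin_lub => _ [x Ax' <-]; exact: Ax.
  - rewrite (left_adjoint_join g_adj) (frame_hom_join (inv_im_hom f)).
    rewrite meet_bigjoin; split=> [/bigjoin_le_ubound Ax y Ay|Ax].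
      by apply: Ax; exists (f^* (g_ y)) => //; exists (g_ y) => //; exists y.
    by apply: bigjoin_lub => _ [_ [_ [y Ay <-] <-] <-]; exact: Ax.
  - by rewrite g_frob (frame_hom_meet (inv_im_hom f)) meetA.
pose p_ w := bigjoin [set z.1 `&` f^* (g_ z.2) |
  z in [set z | p^* z.1 `&` q^* z.2 <= w]].
have p_adj : left_adjoint p_ p^*.
  move=> w x'; apply/idP/idP => [/bigjoin_le_ubound wx|wx].
    rewrite (pullback_cover w); apply: bigjoin_lub => _ [[x y] xyw <-] /=.
    have : x `&` f^* (g_ y) <= x' by apply: wx; exists (x, y).
    move=> /(frame_hom_homo (inv_im_hom p)); apply: le_trans.
    rewrite (frame_hom_meet (inv_im_hom p)) leI2//.
    rewrite -[p^* (f^* _)]/((f \c p)^* _) pb.1 /=.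
    by apply: (frame_hom_homo (inv_im_hom q)); rewrite -g_adj.
  apply: bigjoin_lub => _ [[x y] /= xyw <-].
  apply: (pullback_saturated (sat x')); apply: le_trans xyw _.
  apply: le_trans wx _; apply: bigjoin_ub; exists (x', \top) => /=.
    exact: leIl.
  by rewrite (frame_hom_top (inv_im_hom q)) meetx1.
have p_pure x y : p_ (p^* x `&` q^* y) = x `&` f^* (g_ y).
  apply: le_anti; apply/andP; split; last by apply: bigjoin_ub; exists (x, y) => /=.
  rewrite p_adj (frame_hom_meet (inv_im_hom p)) leI2//.
  rewrite -[p^* (f^* _)]/((f \c p)^* _) pb.1 /=.
  by apply: (frame_hom_homo (inv_im_hom q)); rewrite -g_adj.
exists p_; split=> // x w.
rewrite (pullback_cover w) meet_bigjoin !(left_adjoint_join p_adj) meet_bigjoin.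
rewrite !image_comp; congr bigjoin; apply: eq_imagel => -[a b] _ /=.
by rewrite meetA -(frame_hom_meet (inv_im_hom p)) !p_pure meetA.
Qed.

End Pullbacks.

(** * Generalized elements of a localic groupoid *)

Section Points.
Context (G : localic_groupoid).
Implicit Types (Z : locale).

(** A map [Z -> G1] is treated as an arrow of a groupoid varying over [Z];
    the groupoid axioms, stated on universal elements, are transported to all
    of them by precomposition. *)
Definition composable Z (x y : lmap Z (G1 G)) := rng G \c x = dom G \c y.

Definition point_pair Z (x y : lmap Z (G1 G)) (xy : composable x y) :
    lmap Z (G2 G) :=
  projT1 (cid ((G2_pullback G).2 Z x y xy)).

Lemma point_pair1 Z (x y : lmap Z (G1 G)) (xy : composable x y) :
  pr1 G \c point_pair xy = x.
Proof. by rewrite /point_pair; case: cid => h [[]]. Qed.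

Lemma point_pair2 Z (x y : lmap Z (G1 G)) (xy : composable x y) :
  pr2 G \c point_pair xy = y.
Proof. by rewrite /point_pair; case: cid => h [[]]. Qed.

(** Total, so that [point_mul x y] is the product of [x] and [y] only when
    [rng G \c x = dom G \c y]; the default [x] is arbitrary. *)
Definition point_mul Z (x y : lmap Z (G1 G)) : lmap Z (G1 G) :=
  if pselect (composable x y) is left xy then gmul G \c point_pair xy else x.

Local Notation "x ** y" := (point_mul x y) (at level 52, left associativity).

Lemma point_mulE Z (h : lmap Z (G2 G)) :
  (pr1 G \c h) ** (pr2 G \c h) = gmul G \c h.
Proof.
rewrite /point_mul; case: pselect => [xy|]; last first.
  by case; rewrite /composable !lcompA (G2_pullback G).1.
congr (_ \c _); apply: (pullback_jointly_monic (G2_pullback G)).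
  exact: point_pair1.
exact: point_pair2.
Qed.

Lemma point_pairP Z (x y : lmap Z (G1 G)) : composable x y ->
  exists h : lmap Z (G2 G), [/\ pr1 G \c h = x, pr2 G \c h = y &
    gmul G \c h = x ** y].
Proof.
move=> xy; exists (point_pair xy); rewrite -point_mulE.
by rewrite point_pair1 point_pair2.
Qed.

Lemma dom_point_mul Z (x y : lmap Z (G1 G)) : composable x y ->
  dom G \c (x ** y) = dom G \c x.
Proof. by move=> /point_pairP [h [<- _ <-]]; rewrite !lcompA dom_mul. Qed.

Lemma rng_point_mul Z (x y : lmap Z (G1 G)) : composable x y ->
  rng G \c (x ** y) = rng G \c y.
Proof. by move=> /point_pairP [h [_ <- <-]]; rewrite !lcompA rng_mul. Qed.

Lemma triple_mul : exists mul_id id_mul : lmap (G3 G) (G2 G),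
  [/\ pr1 G \c mul_id = gmul G \c pr12 G, pr2 G \c mul_id = pr2 G \c pr23 G,
      pr1 G \c id_mul = pr1 G \c pr12 G & pr2 G \c id_mul = gmul G \c pr23 G].
Proof.
have [G2sq G3sq] := ((G2_pullback G).1, (G3_pullback G).1).
have [|mi [mi1 mi2 _]] := @point_pairP _ (gmul G \c pr12 G) (pr2 G \c pr23 G).
  by rewrite /composable !lcompA rng_mul -G2sq -!lcompA G3sq.
have [|im [im1 im2 _]] := @point_pairP _ (pr1 G \c pr12 G) (gmul G \c pr23 G).
  by rewrite /composable !lcompA dom_mul G2sq -!lcompA G3sq.
by exists mi, im.
Qed.

Lemma point_mulA Z (x y z : lmap Z (G1 G)) :
  composable x y -> composable y z -> (x ** y) ** z = x ** (y ** z).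
Proof.
move=> xy yz.
have [a [a1 a2 am]] := point_pairP xy.
have [b [b1 b2 bm]] := point_pairP yz.
have [mi [im [mi1 mi2 im1 im2]]] := triple_mul.
have [|t [[t1 t2] _]] := (G3_pullback G).2 Z a b; first by rewrite a2 b1.
have := congr1 (fun h => h \c t) (gmulA mi1 mi2 im1 im2).
rewrite -!lcompA -!point_mulE !lcompA mi1 mi2 im1 im2 -!lcompA t1 t2.
by rewrite am b2 a1 bm.
Qed.

Lemma point_mul1l Z (x : lmap Z (G1 G)) :
  (gunit G \c dom G \c x) ** x = x.
Proof.
have [|k [k1 k2 _]] := @point_pairP _ (gunit G \c dom G) (lid (G1 G)).
  by rewrite /composable lcompA rng_unit lcomp1 lcomp1l.
have := congr1 (fun h => h \c x) (gmul1l k1 k2).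
by rewrite -lcompA -point_mulE !lcompA k1 k2 lcomp1l.
Qed.

Lemma point_mul1r Z (x : lmap Z (G1 G)) :
  x ** (gunit G \c rng G \c x) = x.
Proof.
have [|k [k1 k2 _]] := @point_pairP _ (lid (G1 G)) (gunit G \c rng G).
  by rewrite /composable lcompA dom_unit lcomp1 lcomp1l.
have := congr1 (fun h => h \c x) (gmul1r k1 k2).
by rewrite -lcompA -point_mulE !lcompA k1 k2 lcomp1l.
Qed.

Lemma composable_inv Z (x : lmap Z (G1 G)) : composable x (ginv G \c x).
Proof. by rewrite /composable lcompA dom_inv. Qed.

Lemma composable_invl Z (x : lmap Z (G1 G)) : composable (ginv G \c x) x.
Proof. by rewrite /composable lcompA rng_inv. Qed.

Lemma point_mulV Z (x : lmap Z (G1 G)) :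
  x ** (ginv G \c x) = gunit G \c dom G \c x.
Proof.
have [|k [k1 k2 _]] := @point_pairP _ (lid (G1 G)) (ginv G).
  by rewrite /composable dom_inv lcomp1.
have := congr1 (fun h => h \c x) (gmulV k1 k2).
by rewrite -lcompA -point_mulE !lcompA k1 k2 lcomp1l.
Qed.

Lemma point_mulVl Z (x : lmap Z (G1 G)) :
  (ginv G \c x) ** x = gunit G \c rng G \c x.
Proof.
have [|k [k1 k2 _]] := @point_pairP _ (ginv G) (lid (G1 G)).
  by rewrite /composable rng_inv lcomp1.
have := congr1 (fun h => h \c x) (gmulVl k1 k2).
by rewrite -lcompA -point_mulE !lcompA k1 k2 lcomp1l.
Qed.

Lemma point_mulKV Z (x s : lmap Z (G1 G)) : dom G \c x = dom G \c s ->
  x ** (ginv G \c x ** s) = s.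
Proof.
move=> xs; rewrite -point_mulA; first last.
- by rewrite /composable lcompA rng_inv.
- exact: composable_inv.
by rewrite point_mulV -lcompA xs lcompA point_mul1l.
Qed.

Lemma point_mulK Z (x y : lmap Z (G1 G)) : composable x y ->
  ginv G \c x ** (x ** y) = y.
Proof.
move=> xy; rewrite -point_mulA//; last exact: composable_invl.
by rewrite point_mulVl -lcompA xy lcompA point_mul1l.
Qed.

Lemma point_inv_unique Z (x y : lmap Z (G1 G)) : composable x y ->
  x ** y = gunit G \c dom G \c x -> y = ginv G \c x.
Proof.
move=> xy xy1; rewrite -(point_mulK xy) xy1 -rng_inv -2!lcompA lcompA.
exact: point_mul1r.
Qed.

Lemma ginvK : ginv G \c ginv G = lid (G1 G).
Proof.
apply/esym/point_inv_unique; first by rewrite /composable rng_inv lcomp1.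
have := point_mulVl (lid (G1 G)).
by rewrite !lcomp1 -(lcompA (gunit G)) dom_inv.
Qed.

Lemma ginv_mul : ginv G \c gmul G = (ginv G \c pr2 G) ** (ginv G \c pr1 G).
Proof.
set x := pr1 G; set y := pr2 G.
have xy : composable x y := (G2_pullback G).1.
have ab : composable (ginv G \c y) (ginv G \c x).
  by rewrite /composable !lcompA rng_inv dom_inv.
have mE : gmul G = x ** y by have := point_mulE (lid (G2 G)); rewrite !lcomp1.
apply/esym/point_inv_unique.
  by rewrite /composable dom_point_mul// rng_mul lcompA dom_inv.
rewrite {1}mE point_mulA//; last first.
  by rewrite /composable dom_point_mul// lcompA dom_inv.
rewrite -(@point_mulA _ y)//; last exact: composable_inv.
rewrite point_mulV -lcompA -xy -dom_inv -(lcompA (dom G)) lcompA point_mul1l.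
by rewrite point_mulV mE -(lcompA _ _ (x ** y)) dom_point_mul// lcompA.
Qed.

(** * Pullback squares in a groupoid *)

(** A pair [(s, x)] with common domain determines the composable pair of [x] and
    the product of the inverse of [x] with [s], whose product is [s]. *)
Lemma gmul_pullback : is_pullback (dom G) (dom G) (gmul G) (pr1 G).
Proof.
split; first exact: dom_mul.
move=> Z s x sx; have xs : composable x (ginv G \c x ** s).
  by rewrite /composable dom_point_mul ?lcompA ?dom_inv// /composable lcompA rng_inv.
have [h [h1 h2 hm]] := point_pairP xs.
exists h; split; first by rewrite hm point_mulKV.
move=> k [km k1]; apply: (pullback_jointly_monic (G2_pullback G)).
  by rewrite h1 k1.
rewrite h2 -km -point_mulE k1 point_mulK// /composable -k1.
by rewrite !lcompA (G2_pullback G).1.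
Qed.

Section Triples.
Context (mul_id id_mul : lmap (G3 G) (G2 G)).
Hypothesis mul_id1 : pr1 G \c mul_id = gmul G \c pr12 G.
Hypothesis mul_id2 : pr2 G \c mul_id = pr2 G \c pr23 G.
Hypothesis id_mul1 : pr1 G \c id_mul = pr1 G \c pr12 G.
Hypothesis id_mul2 : pr2 G \c id_mul = gmul G \c pr23 G.

(** A composable triple amounts to a pair [(s, z)] together with a
    factorization of [s] as a product. *)
Lemma mul_id_pullback : is_pullback (pr1 G) (gmul G) mul_id (pr12 G).
Proof.
split=> // Z a b ab.
have bc : composable (pr2 G \c b) (pr2 G \c a).
  rewrite /composable lcompA -rng_mul -lcompA -ab !lcompA.
  by rewrite (G2_pullback G).1.
have [c [c1 c2 _]] := point_pairP bc.
have [h [[h12 h23] hu]] := (G3_pullback G).2 Z b c (esym c1).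
exists h; split.
  split=> //; apply: (pullback_jointly_monic (G2_pullback G)).
    by rewrite lcompA mul_id1 -lcompA h12 ab.
  by rewrite lcompA mul_id2 -lcompA h23 c2.
move=> k [ka kb]; apply: hu; split=> //.
apply: (pullback_jointly_monic (G2_pullback G)).
  by rewrite lcompA -(G3_pullback G).1 -lcompA kb c1.
by rewrite lcompA -mul_id2 -lcompA ka c2.
Qed.

Lemma id_mul_pullback : is_pullback (pr2 G) (gmul G) id_mul (pr23 G).
Proof.
split=> // Z a b ab.
have cb : composable (pr1 G \c a) (pr1 G \c b).
  rewrite /composable (lcompA (dom G)) -dom_mul -lcompA -ab !lcompA.
  by rewrite (G2_pullback G).1.
have [c [c1 c2 _]] := point_pairP cb.
have [h [[h12 h23] hu]] := (G3_pullback G).2 Z c b c2.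
exists h; split.
  split=> //; apply: (pullback_jointly_monic (G2_pullback G)).
    by rewrite lcompA id_mul1 -lcompA h12 c1.
  by rewrite lcompA id_mul2 -lcompA h23 ab.
move=> k [ka kb]; apply: hu; split=> //.
apply: (pullback_jointly_monic (G2_pullback G)).
  by rewrite lcompA -id_mul1 -lcompA ka c1.
by rewrite lcompA (G3_pullback G).1 -lcompA kb c2.
Qed.
End Triples.
End Points.

(** * The quantale of a quantal groupoid *)

Local Open Scope quantale_scope.
Local Notation "x ** y" := (point_mul x y) (at level 52, left associativity).

Arguments qmul : simpl never.
Arguments qinv : simpl never.

Section GroupoidQuantale.
Context (G : localic_groupoid).
Hypothesis quantalG : quantal G.
Local Notation Q := (groupoid_quantale G).
Implicit Types (a b c x y : Q).

Lemma qmulE a b : a * b = direct_im (gmul G) ((pr1 G)^*%L a `&` (pr2 G)^*%L b).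
Proof. by []. Qed.

Lemma qmul_le a b c :
  (a * b <= c) = ((pr1 G)^*%L a `&` (pr2 G)^*%L b <= (gmul G)^*%L c).
Proof. exact: (direct_imP quantalG). Qed.

Lemma ginvKE (a : opens (G1 G)) : (ginv G)^*%L ((ginv G)^*%L a) = a.
Proof. exact: (congr1 (fun h => inv_im h a) (ginvK G)). Qed.

(** Inversion is its own inverse, so its direct image is its inverse image. *)
Lemma qinvE a : a^* = (ginv G)^*%L a.
Proof.

have gf : left_adjoint (ginv G)^*%L (ginv G)^*%L.
  move=> b c; apply/idP/idP => /(frame_hom_homo (inv_im_hom (ginv G)));
    by rewrite ginvKE.
by rewrite [RHS](congr1 (@^~ a) (ladjP gf)).
Qed.

Lemma qmul_point Z (x y : lmap Z (G1 G)) a b c : composable x y ->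
  a * b <= c -> x^*%L a `&` y^*%L b <= (x ** y)^*%L c.
Proof.
move=> /point_pairP [h [<- <- <-]]; rewrite qmul_le.
by move=> /(frame_hom_homo (inv_im_hom h)); rewrite (frame_hom_meet (inv_im_hom h)).
Qed.

(** The converse companion of [qmul_point]: the rectangles below
    [(gmul G)^* a] cover it. *)
Lemma point_mul_cover Z (x y : lmap Z (G1 G)) a : composable x y ->
  (x ** y)^*%L a =
  bigjoin [set x^*%L p.1 `&` y^*%L p.2 | p in [set p : Q * Q | p.1 * p.2 <= a]].
Proof.
move=> /point_pairP [h [<- <- <-]] /=.
rewrite {1}(pullback_cover (G2_pullback G) ((gmul G)^*%L a)).
rewrite (frame_hom_join (inv_im_hom h)) image_comp.
congr bigjoin; apply/seteqP; split=> _ [p pa <-]; exists p;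
  rewrite /= ?(frame_hom_meet (inv_im_hom h))//.
- by rewrite qmul_le.
- by rewrite -qmul_le.
Qed.

Lemma qmul_joinl_groupoid b : preserves_joins (fun a => a * b).
Proof.
move=> A; rewrite qmulE (frame_hom_join (inv_im_hom (pr1 G))) bigjoin_meet.
by rewrite (left_adjoint_join (direct_imP quantalG)) !image_comp.
Qed.

Lemma qmul_joinr_groupoid a : preserves_joins (fun b => a * b).
Proof.
move=> A; rewrite qmulE (frame_hom_join (inv_im_hom (pr2 G))) meet_bigjoin.
by rewrite (left_adjoint_join (direct_imP quantalG)) !image_comp.
Qed.

(** Evaluate at the inverses of the two projections, taken in the opposite
    order; their product is the inverse of the multiplication map. This gives
    one inequality, and the other follows since the involution is
    self-inverse. *)
Lemma qinv_mul a b : (a * b)^* = b^* * a^*.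
Proof.
have le (c d : Q) : (c * d)^* <= d^* * c^*.
  have xy : composable (ginv G \c pr2 G) (ginv G \c pr1 G).
    by rewrite /composable !lcompA rng_inv dom_inv (G2_pullback G).1.
  rewrite qinvE; set e := d^* * c^*.
  have := qmul_point xy (lexx e); rewrite -ginv_mul /=.
  rewrite !qinvE !ginvKE meetC -qmul_le => cd.
  by have := frame_hom_homo (inv_im_hom (ginv G)) cd; rewrite ginvKE.
apply: le_anti; rewrite le /=.
have := frame_hom_homo (inv_im_hom (ginv G)) (le b^* a^*).
by rewrite !qinvE !ginvKE.
Qed.

Lemma involutive_groupoid : associative (@qmul Q) -> involutive_quantal_frame Q.
Proof.
move=> mulA; split=> //.
- exact: qmul_joinl_groupoid.
- exact: qmul_joinr_groupoid.
- move=> A; rewrite qinvE (frame_hom_join (inv_im_hom (ginv G))).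
  by congr bigjoin; apply: eq_imagel => a _; rewrite qinvE.
- by move=> a; rewrite !qinvE ginvKE.
- exact: qinv_mul.
Qed.

(** Every arrow is its own product with a unit on the right. *)
Lemma le_mul_top a : a <= a * \top.
Proof.
have c1 : composable (lid (G1 G)) (gunit G \c rng G \c lid (G1 G)).
  by rewrite /composable 2!lcompA dom_unit lcomp1l.
have := qmul_point c1 (lexx (a * \top)).
rewrite point_mul1r /= (frame_hom_top (inv_im_hom (gunit G))).
by rewrite (frame_hom_top (inv_im_hom (rng G))) meetx1.
Qed.

(** A product has the domain of its first factor. *)
Lemma dom_right_sided (v : opens (G0 G)) : right_sided ((dom G)^*%L v : Q).
Proof.
rewrite /right_sided /= qmul_le.
have /(congr1 (fun h => inv_im h v)) /= -> := dom_mul G.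
exact: leIl.
Qed.

(** One inequality comes from [x ** x^-1 = u d x], the other from multiplying
    the unit at [d x] on the right by [x]. *)
Lemma right_sidedE a : right_sided a -> a = (dom G)^*%L ((gunit G)^*%L a).
Proof.
rewrite /right_sided /= => aR; apply: le_anti; apply/andP; split.
  have := qmul_point (composable_inv (lid (G1 G))) aR.
  by rewrite point_mulV /= (frame_hom_top (inv_im_hom (ginv G))) meetx1.
have c1 : composable (gunit G \c dom G \c lid (G1 G)) (lid (G1 G)).
  by rewrite /composable 2!lcompA rng_unit lcomp1l.
have := qmul_point c1 aR.
by rewrite point_mul1l /= meetx1.
Qed.

(** The cover of the inverse image of [a] under [x |-> x ** x^-1] is the join
    defining [upsilon a]. *)
Lemma upsilonE a : upsilon a = (dom G)^*%L ((gunit G)^*%L a).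
Proof.
have := point_mul_cover a (composable_inv (lid (G1 G))).
rewrite point_mulV /= => ->; congr bigjoin; apply/seteqP; split.
  move=> _ [x [y [xya ->]]]; exists (x, y^*) => //=.
  by rewrite qinvE ginvKE.
move=> _ [[x y] /= xya <-]; exists x, (y : Q)^*; split; last by rewrite qinvE.
by rewrite !qinvE ginvKE.
Qed.

Section Associative.
Hypothesis mulA : associative (@qmul Q).

Lemma mul_top_right_sided a : right_sided (a * \top).
Proof.
rewrite /right_sided /= -mulA; apply: (preserves_joins_homo (qmul_joinr_groupoid a)).
exact: lex1.
Qed.

Lemma right_sided_range : @right_sided Q = range (fun a : Q => a * \top).
Proof.
apply/seteqP; split=> [a aR|_ [a _ <-]]; last exact: mul_top_right_sided.
by exists a => //; apply: le_anti; rewrite aR le_mul_top.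
Qed.

(** Both sides restrict the second arrow's domain, equivalently the first
    arrow's range, to the same open of [G0]. *)
Lemma balanced_groupoid : balanced Q.
Proof.
move=> a b c.
have topV : (\top : Q)^* = \top by rewrite qinvE (frame_hom_top (inv_im_hom _)).
have -> : \top * a^* = (a * \top)^* by rewrite qinv_mul topV.
rewrite (right_sidedE (mul_top_right_sided a)).
move: ((gunit G)^*%L _) => v; rewrite qinvE !qmulE.
rewrite !(frame_hom_meet (inv_im_hom _)).
have /(congr1 (fun h => inv_im h v)) /= -> := dom_inv G.
have /(congr1 (fun h => inv_im h v)) /= -> := (G2_pullback G).1.
by rewrite meetA.
Qed.

(** Both inequalities evaluate at [x ** (x^-1 ** x) = x]. For the harder one,
    cover [a] by the [x `&` z^* `&` w] with [x * (z * w) <= a]; the element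
    [t = x `&` z^* `&` w] then satisfies [t * t^* * t <= a]. *)
Lemma regular_groupoid a : bigjoin [set x | x * x^* * x <= a] = a.
Proof.
have inv1 := composable_inv (lid (G1 G)).
have invl := composable_invl (lid (G1 G)).
have id3 : lid (G1 G) ** ((ginv G \c lid (G1 G)) ** lid (G1 G)) = lid (G1 G).
  exact: point_mulKV.
have c3 : composable (lid (G1 G)) ((ginv G \c lid (G1 G)) ** lid (G1 G)).
  by rewrite /composable dom_point_mul.
have c3' : composable (lid (G1 G) ** (ginv G \c lid (G1 G))) (lid (G1 G)).
  by rewrite /composable rng_point_mul.
apply: le_anti; apply/andP; split.
  apply: bigjoin_lub => x /= xa.
  have := qmul_point c3' xa; rewrite point_mulA// id3 /=.
  apply: le_trans; rewrite lexI lexx andbT.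
  have := qmul_point inv1 (lexx (x * x^*)).
  by apply: le_trans; rewrite /= qinvE ginvKE meetxx.
have := point_mul_cover a c3; rewrite id3 /= => {1}->.
apply: bigjoin_lub => _ [[x y] /= xya <-].
rewrite (point_mul_cover y invl) meet_bigjoin.
apply: bigjoin_lub => _ [_ [[z w] /= zwy <-] <-].
apply: bigjoin_ub => /=; set t : Q := (X in X * _ * X).
rewrite -mulA; apply: le_trans xya.
have tx : t <= x by exact: leIl.
have tz : t^* <= z.
  rewrite qinvE -[leRHS]ginvKE; apply: (frame_hom_homo (inv_im_hom _)).
  exact: le_trans (leIr _ _) (leIl _ _).
have tw : t <= w by exact: le_trans (leIr _ _) (leIr _ _).
apply: (le_trans (preserves_joins_homo (qmul_joinl_groupoid _) tx)).
apply: (preserves_joins_homo (qmul_joinr_groupoid _)); apply: le_trans zwy.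
apply: (le_trans (preserves_joins_homo (qmul_joinl_groupoid _) tz)).
exact: (preserves_joins_homo (qmul_joinr_groupoid _) tw).
Qed.

Lemma semiopen_groupoid : semiopen_quantal_frame Q.
Proof.
split.
- exact: involutive_groupoid.
- exact: balanced_groupoid.
- by move=> a; rewrite upsilonE; exact: dom_right_sided.
- exact: regular_groupoid.
Qed.

Lemma qmul_balanced z a b : right_sided z -> (a `&` z^*) * b = a * (z `&` b).
Proof.
rewrite right_sided_range => -[y _ <-]; rewrite balanced_groupoid.
by rewrite qinv_mul [\top^*]qinvE (frame_hom_top (inv_im_hom _)).
Qed.

(** Right-sided elements include all [d^* v], and the involution turns [d^*]
    into [r^*], so the balancing relation is the one of the fiber product
    [G2]. *)
Lemma saturated_fiber (U : set (Q * Q)%type) :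
  saturated U -> fiber_saturated (rng G) (dom G) U.
Proof.
move=> Us; split.
- exact: saturated_joinl Us.
- exact: saturated_joinr Us.
- move=> v x y; have := saturated_balanced Us x y (dom_right_sided v).
  rewrite qinvE.
  by have /(congr1 (fun h => inv_im h v)) /= -> := dom_inv G.
Qed.

(** The right adjoint sends [a] to the set of [(x, y)] with [x * y <= a], that
    is, to the rectangles of [G2] below [m^* a]. Since [m^*] preserves joins, a
    rectangle in the image of a join is covered by rectangles in the join of
    the images, hence belongs to it. *)
Lemma multiplicative_groupoid : multiplicative Q.
Proof.
split; [exact: balanced_groupoid|exact: right_sided_range|].
have le_radj (t : tensor Q) a : (reduced_mul t <= a) = (t <= radj (@reduced_mul Q) a).
  apply: radjP; apply: tensor_lift_join => //.
  - exact: qmul_joinl_groupoid.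
  - exact: qmul_joinr_groupoid.
  - by move=> z {}a b; exact: qmul_balanced.
have pure_mul x y : reduced_mul (pure_tensor x y) = x * y.
  apply: tensor_lift_pure.
  - exact: qmul_joinl_groupoid.
  - exact: qmul_joinr_groupoid.
  - by move=> z a b; exact: qmul_balanced.
have radjE x y a : tset (radj (@reduced_mul Q) a) (x, y) <-> x * y <= a.
  by rewrite -pure_mul le_radj; exact: iff_sym (pure_tensor_le _ _ _).
move=> A; apply: le_anti; apply/andP; split; last first.
  apply: bigjoin_lub => _ [a Aa <-]; apply/le_tensorP => -[x y].
  by move=> /radjE xya; apply/radjE/(le_trans xya)/bigjoin_ub.
apply/le_tensorP => -[x y] /radjE; rewrite qmul_le => xyA.
set J := bigjoin _.
apply: (pullback_saturated (G2_pullback G) (saturated_fiber (tset_saturated J))).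
apply: le_trans xyA _; rewrite (frame_hom_join (inv_im_hom _)).
apply: bigjoin_lub => _ [a Aa <-].
rewrite (pullback_cover (G2_pullback G) (inv_im _ _)).
apply: bigjoin_lub => _ [[x' y'] /= xya <-]; apply: bigjoin_ub.
exists (x', y') => //; suff /le_tensorP : radj (@reduced_mul Q) a <= J.
  by apply; apply/radjE; rewrite qmul_le.
by apply: bigjoin_ub; exists a.
Qed.

End Associative.

Section Open.
Hypothesis openG : open_groupoid G.

Lemma gmul_open : exists2 m_ : opens (G2 G) -> opens (G1 G),
  left_adjoint m_ (gmul G)^*%L &
  forall a w, m_ ((gmul G)^*%L a `&` w) = a `&` m_ w.
Proof.
case: openG => d_ d_adj d_frob.
by have [m_ [m_adj _ m_frob]] := pullback_open (gmul_pullback G) d_adj d_frob; exists m_.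
Qed.

Lemma direct_im_gmul_frobenius a (w : opens (G2 G)) :
  direct_im (gmul G) ((gmul G)^*%L a `&` w) = a `&` direct_im (gmul G) w.
Proof. by case: gmul_open => m_ /ladjP mE; rewrite /direct_im -mE. Qed.

(** By Beck-Chevalley for the two multiplication maps from triples to pairs,
    both bracketings are direct images, under the triple multiplication, of
    the open of triples given by [a], [b] and [c]. *)
Lemma open_qmulA : associative (@qmul Q).
Proof.
have m_adj := direct_imP quantalG.
have [mi [im [mi1 mi2 im1 im2]]] := triple_mul G.
have [mi_ [mi_adj mi_bc _]] :=
  pullback_open (mul_id_pullback mi1 mi2) m_adj direct_im_gmul_frobenius.
have [im_ [im_adj im_bc _]] :=
  pullback_open (id_mul_pullback im1 im2) m_adj direct_im_gmul_frobenius.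
have triple_adj : direct_im (gmul G) \o im_ = direct_im (gmul G) \o mi_.
  transitivity (ladj (gmul G \c im)^*%L).
    by apply: ladjP => w a; rewrite /= m_adj im_adj.
  rewrite -(gmulA mi1 mi2 im1 im2); apply/esym/ladjP => w a.
  by rewrite /= m_adj mi_adj.
move=> a b c.
have -> : a * (b * c) = direct_im (gmul G) (im_ (im^*%L ((pr1 G)^*%L a) `&`
    (pr23 G)^*%L ((pr1 G)^*%L b `&` (pr2 G)^*%L c))) by rewrite im_bc.
have -> : a * b * c = direct_im (gmul G) (mi_ (mi^*%L ((pr2 G)^*%L c) `&`
    (pr12 G)^*%L ((pr1 G)^*%L a `&` (pr2 G)^*%L b))) by rewrite mi_bc meetC.
rewrite -[RHS](congr1 (@^~ _) triple_adj) /=; congr (direct_im _ (im_ _)).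
rewrite !(frame_hom_meet (inv_im_hom _)).
have /(congr1 (fun h => inv_im h a)) /= -> := im1.
have /(congr1 (fun h => inv_im h c)) /= -> := mi2.
have /(congr1 (fun h => inv_im h b)) /= -> := (G3_pullback G).1.
by rewrite meetA meetC.
Qed.

Lemma open_groupoid_quantale : open_quantal_frame Q.
Proof.
split; first exact: semiopen_groupoid open_qmulA.
move=> a b c.
rewrite (right_sidedE (mul_top_right_sided open_qmulA a)).
rewrite !qmulE -direct_im_gmul_frobenius (frame_hom_meet (inv_im_hom _)) meetA.
move: ((gunit G)^*%L _) => v.
by have /(congr1 (fun h => inv_im h v)) /= -> := dom_mul G.
Qed.

End Open.
End GroupoidQuantale.

Theorem theorem2p51 (G : localic_groupoid) (quantalG : quantal G) :
  (associative (@qmul (groupoid_quantale G)) ->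
     semiopen_quantal_frame (groupoid_quantale G) /\
     multiplicative (groupoid_quantale G)) /\
  (open_groupoid G -> open_quantal_frame (groupoid_quantale G)).
Proof.
split=> [mulA|openG]; last exact: open_groupoid_quantale.
by split; [exact: semiopen_groupoid|exact: multiplicative_groupoid].
Qed.
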